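(* Let $R$ be a countable prehomogeneous relational structure such that $\mathrm{Aut}(R)$ is oligomorphic. (a) If $R$ has infinitely many monomorphic components, then $\mathrm{sib}(R)$ is infinite. (b) If $R$ has infinitely many infinite monomorphic components, then $\mathrm{sib}(R)=2^{\aleph_0}$.
   Context: A relational structure with domain $E$ is $R=(E,(\rho_i)_{i\in I})$ with $\rho_i\subseteq E^{n_i}$. For $A\subseteq E$, $R_{\restriction A}=(A,(A^{n_i}\cap\rho_i)_{i\in I})$. A local isomorphism of $R$ is an isomorphism from a restriction $R_{\restriction F}$ onto a restriction $R_{\restriction F'}$. A structure $S$ embeds into $R$ if $S$ is isomorphic to a restriction of $R$. A sibling of $R$ is a structure $S$ such that $S$ embeds into $R$ and $R$ embeds into $S$; $\mathrm{sib}(R)$ is the number of siblings up to isomorphism. $R$ is prehomogeneous if for every finite $F\subseteq E$ there is a finite $F'$ with $F\subseteq F'\subseteq E$ such that every local isomorphism of $R$ with domain $F$ extends to an automorphism of $R$ provided that it extends to a local isomorphism with domain $F'$. A permutation group on $E$ is oligomorphic if for every integer $n$ it has finitely many orbits on $n$-element subsets of $E$. A subset $E'\subseteq E$ is a monomorphic part of $R$ if for every integer $k$ and every pair $A,A'$ of $k$-element subsets of $E$ with $A\setminus E'=A'\setminus E'$, the structures $R_{\restriction A}$ and $R_{\restriction A'}$ are isomorphic. A monomorphic component is a monomorphic part maximal for inclusion; the monomorphic components form a partition of $E$. *)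

(* Defs.v *)
From mathcomp Require Import all_boot.
From mathcomp Require Import boolp classical_sets functions cardinality.
Set Implicit Arguments.
Unset Strict Implicit.
Unset Printing Implicit Defensive.

Local Open Scope classical_set_scope.
Local Open Scope card_scope.

(* The signature [ar : I -> nat] is fixed, as isomorphisms, embeddings and
   siblings only compare structures of the same signature; [I] is arbitrary. *)
Record structure (I : Type) (ar : I -> nat) := Structure {
  domain :> Type;
  rel_of : forall i : I, set ((ar i).-tuple domain)
}.

Section Definitions.
Variables (I : Type) (ar : I -> nat).
Implicit Types R S T : structure ar.

(* The carrier is [set_type A] written out: [set_type] itself would force the
   universe of [domain] up to that of [set], and [set (structure ar)] below
   would be inconsistent. *)
Definition restriction R (A : set R) : structure ar :=
  @Structure I ar {x : R | x \in A} (fun i t => rel_of (map_tuple val t)).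

Definition is_iso S T (f : S -> T) : Prop :=
  bijective f /\
  forall (i : I) (t : (ar i).-tuple S), rel_of t <-> rel_of (map_tuple f t).

Definition isomorphic S T : Prop := exists f : S -> T, is_iso f.

Definition embeds S R : Prop := exists A : set R, isomorphic S (restriction A).

Definition sibling R S : Prop := embeds S R /\ embeds R S.

Definition iso_class S : set (structure ar) := [set T | isomorphic S T].

(* The number of siblings up to isomorphism is the cardinality of this set. *)
Definition sib R : set (set (structure ar)) :=
  [set iso_class S | S in [set S | sibling R S]].

Definition Aut R : set (R -> R) := [set phi | is_iso phi].

(* A local isomorphism of [R] with domain [F] is a map
   [f : restriction F -> restriction G], for some [G], with [is_iso f]. *)
Definition prehomogeneous R : Prop :=
  forall F : set R, finite_set F ->
  exists F' : set R, [/\ finite_set F', F `<=` F' &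
    forall (G : set R) (f : restriction F -> restriction G), is_iso f ->
      (exists (G' : set R) (g : restriction F' -> restriction G'),
         is_iso g /\
         forall (x : restriction F) (y : restriction F'),
           val x = val y -> val (f x) = val (g y)) ->
      exists phi : R -> R,
        is_iso phi /\ forall x : restriction F, val (f x) = phi (val x)].

Definition orbit_of_set (E : Type) (H : set (E -> E)) (A : set E) :
  set (set E) := [set h @` A | h in H].

(* [H] is meant to be the set of the elements of a permutation group on [E]. *)
Definition oligomorphic (E : Type) (H : set (E -> E)) : Prop :=
  forall n : nat,
    finite_set [set orbit_of_set H A | A in [set A : set E | A #= `I_n]].

Definition monomorphic_part R (E' : set R) : Prop :=
  forall (k : nat) (A A' : set R), A #= `I_k -> A' #= `I_k ->
    A `\` E' = A' `\` E' -> isomorphic (restriction A) (restriction A').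

Definition monomorphic_component R (C : set R) : Prop :=
  monomorphic_part C /\
  forall D : set R, monomorphic_part D -> C `<=` D -> D = C.

End Definitions.

Arguments Aut {I ar} R _.

(* Main.v *)
Require Import Defs.
From HB Require Import structures.
From mathcomp Require Import all_boot finmap.
From mathcomp Require Import boolp classical_sets functions cardinality filter.
From mathcomp Require Import zify.
Set Implicit Arguments.
Unset Strict Implicit.
Unset Printing Implicit Defensive.

Local Open Scope classical_set_scope.
Local Open Scope card_scope.

(** Call [x] and [y] exchangeable if [x |` F] and [y |` F] carry isomorphic
    structures for every finite [F] avoiding both. This is an equivalence
    relation whose classes are the nonempty monomorphic components
    ([monomorphic_component_class]), and the sizes of its classes are
    isomorphism invariants, by which siblings are told apart.

    Siblings are restrictions [restriction A] into which [R] embeds. Since the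
    automorphism group is oligomorphic, the pointwise stabilizer of a finite
    set has finitely many orbits, and Koenig's lemma turns finite
    approximations into self-maps of [R] with prescribed finite behaviour
    ([compactness]). It also bounds the size of the finite classes, and gives
    a bound [N] on the size of a set [F] that witnesses the inexchangeability
    of two points. The latter bound makes large classes robust: if an infinite
    class is cut down to more than [N] + 1 points, the points of a witness [F]
    that were lost can be replaced by remaining points of the same class. So
    the classes of the restriction are the traces of the classes of [R]
    ([class_replaceable]).

    If infinitely many classes are infinite, compactness yields an embedding
    of [R] into itself whose image misses infinitely many infinite classes
    ([selfembedding_off_classes]). These classes may be cut down to any large
    finite sizes, and the set of sizes used is an invariant; this gives as
    many siblings as there are sets of natural numbers. There are no more,
    because a sibling is determined up to isomorphism by a subset of a
    countable set.

    If there are infinitely many classes, it suffices to find siblings with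
    bounded finite classes, one of which is as large as one likes. Pick points
    [d j] in distinct classes, and an ultrafilter [V] on the indices. A class
    is absorbing if its points look, over every finite set, like [d j] for
    [V]-almost all [j]. If some infinite class is absorbing, its points may be
    replaced by points [d j], so that [R] embeds into the complement of that
    class ([emb_off_absorbing]); keeping [k] points of the class gives a
    sibling with a class of size [k] ([shrunk_absorbing_sibling]). Otherwise,
    adjoin to [R] a generic sequence of [k] points: over [R] the isomorphism
    type depends only on the number of adjoined points, being the iterated
    limit along [V] of the types of points [d j] ([generic_extension]). The
    [k] points are exchangeable, and as they can only join a class that is
    absorbing, hence finite, their class is finite ([inflated_sibling]). *)

(** * Isomorphisms and embeddings *)

(* Opaque, so that rewriting never unfolds the equality test. *)
Fact domain_eqMixin (I : Type) (ar : I -> nat) (R : structure ar) :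
  hasDecEq (domain R).
Proof. exact: gen_eqMixin. Qed.

HB.instance Definition _ (I : Type) (ar : I -> nat) (R : structure ar) :=
  domain_eqMixin R.
HB.instance Definition _ (I : Type) (ar : I -> nat) (R : structure ar) :=
  gen_choiceMixin (domain R).

Section Isomorphisms.
Variables (I : Type) (ar : I -> nat).
Implicit Types R S T : structure ar.

Lemma is_iso_id R : is_iso (@id R).
Proof.
split=> [|i t]; first by exists id.
by rewrite (_ : map_tuple id t = t)//; apply/val_inj/map_id.
Qed.

Lemma map_tuple_comp n (A B C : Type) (f : A -> B) (g : B -> C)
  (t : n.-tuple A) : map_tuple (g \o f) t = map_tuple g (map_tuple f t).
Proof. by apply/val_inj; rewrite /= map_comp. Qed.

Lemma is_iso_comp R S T (f : R -> S) (g : S -> T) :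
  is_iso f -> is_iso g -> is_iso (g \o f).
Proof.
move=> [bf hf] [bg hg]; split; first exact: bij_comp.
by move=> i t; rewrite map_tuple_comp -hg.
Qed.

Lemma is_iso_inv R S (f : R -> S) :
  is_iso f -> exists g : S -> R, [/\ is_iso g, cancel f g & cancel g f].
Proof.
move=> [[g fK gK] hf]; exists g; split=> //; split; first by exists f.
move=> i t; rewrite hf -map_tuple_comp.
have -> : map_tuple (f \o g) t = t; last exact: iff_refl.
by apply: eq_from_tnth => j; rewrite tnth_map /= gK.
Qed.

Lemma isomorphic_refl R : isomorphic R R.
Proof. by exists id; exact: is_iso_id. Qed.

Lemma isomorphic_sym R S : isomorphic R S -> isomorphic S R.
Proof. by move=> [f /is_iso_inv[g [? _ _]]]; exists g. Qed.

Lemma isomorphic_trans S R T :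
  isomorphic R S -> isomorphic S T -> isomorphic R T.
Proof. by move=> [f hf] [g hg]; exists (g \o f); exact: is_iso_comp. Qed.

Lemma iso_class_eq R S : isomorphic R S -> iso_class R = iso_class S.
Proof.
move=> RS; apply/seteqP; split=> T /= h; apply: isomorphic_trans h => //.
exact: isomorphic_sym.
Qed.

Lemma iso_class_inj R S : iso_class R = iso_class S -> isomorphic R S.
Proof.
move=> RS; have : iso_class S S by exact: isomorphic_refl.
by rewrite -RS.
Qed.

(** Total functions restricted to a set stand for local embeddings, so that
    composition and change of domain need no dependent types. *)
Definition emb_on R S (A : set R) (f : R -> S) :=
  (forall x y, A x -> A y -> f x = f y -> x = y) /\
  forall i (t : (ar i).-tuple R),
    (forall j, A (tnth t j)) -> rel_of t <-> rel_of (map_tuple f t).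

Lemma emb_on_sub R S (A B : set R) (f : R -> S) :
  A `<=` B -> emb_on B f -> emb_on A f.
Proof.
move=> AB [injf relf]; split=> [x y /AB Bx /AB By|i t At]; first exact: injf.
by apply: relf => j; exact: AB.
Qed.

Lemma emb_on_eq R S (A : set R) (f g : R -> S) :
  (forall x, A x -> f x = g x) -> emb_on A f -> emb_on A g.
Proof.
move=> fg [injf relf]; split=> [x y Ax Ay|i t At].
  by rewrite -!fg//; exact: injf.
rewrite relf// (_ : map_tuple f t = map_tuple g t)//.
by apply: eq_from_tnth => j; rewrite !tnth_map fg.
Qed.

Lemma emb_on_comp R S T (A : set R) (B : set S) (f : R -> S) (g : S -> T) :
  (forall x, A x -> B (f x)) -> emb_on A f -> emb_on B g -> emb_on A (g \o f).
Proof.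
move=> AB [injf relf] [injg relg]; split=> [x y Ax Ay /= e|i t At].
  by apply: injf => //; apply: injg => //; exact: AB.
rewrite map_tuple_comp relf// relg// => j.
by rewrite tnth_map; exact: AB.
Qed.

Lemma is_iso_emb R S (f : R -> S) : is_iso f -> emb_on setT f.
Proof.
by move=> [/bij_inj injf relf]; split=> [x y _ _ /injf|i t _].
Qed.

Lemma emb_on_val R (A : set R) : emb_on setT (val : restriction A -> R).
Proof. by split=> [x y _ _ /val_inj|]. Qed.

Definition lift_to (T : Type) R (B : set R) (f : T -> R)
    (fB : forall x, B (f x)) (x : T) : restriction B :=
  exist (fun y => y \in B) (f x) (mem_set (fB x)).

Lemma isomorphic_img R S (A : set R) (B : set S) (f : R -> S) :
  emb_on A f -> f @` A = B -> isomorphic (restriction A) (restriction B).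
Proof.
move=> [injf relf] fAB.
have fB (x : restriction A) : B (f (val x)).
  by rewrite -fAB; exists (val x) => //; apply: set_mem; exact: (svalP x).
exists (lift_to fB); split.
  have gP (y : restriction B) : exists x : restriction A, f (val x) = val y.
    have : (f @` A) (val y) by rewrite fAB; apply: set_mem; exact: (svalP y).
    by move=> [x Ax <-]; exists (exist _ x (mem_set Ax)).
  have [g gK] := choice gP; exists g.
    move=> x; apply/val_inj/injf; try by apply: set_mem; exact: valP.
    by rewrite gK.
  by move=> y; apply/val_inj; rewrite /= gK.
move=> i t; rewrite /rel_of/=.
rewrite relf; last first.
  by move=> j; rewrite tnth_map; apply: set_mem; exact: valP.
rewrite -!map_tuple_comp; apply: iff_refl.
Qed.

Lemma isomorphic_emb R (A B : set R) :
  isomorphic (restriction A) (restriction B) ->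
  exists f : R -> R, emb_on A f /\ f @` A = B.
Proof.
move=> [f [bf relf]].
pose g (x : R) : R := if pselect (x \in A) is left xA
  then val (f (exist (fun x => x \in A) x xA)) else x.
have gE (x : restriction A) : g (val x) = val (f x).
  rewrite /g; case: pselect => [xA|]; last by case: (x).
  by congr (val (f _)); exact: val_inj.
have lft x (Ax : A x) : x = val (exist (fun x => x \in A) x (mem_set Ax)) by [].
exists g; split; first split.
- move=> x y Ax Ay; rewrite (lft _ Ax) (lft _ Ay) !gE.
  by move=> /val_inj /(bij_inj bf) ->.
- move=> i t At.
  have [u ut] : exists u : (ar i).-tuple (restriction A), map_tuple val u = t.
    exists [tuple (exist (fun x => x \in A) (tnth t j) (mem_set (At j))
      : restriction A) | j < ar i].
    by apply: eq_from_tnth => j; rewrite tnth_map tnth_mktuple.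
  have := relf i u; rewrite /rel_of/= ut => h.
  apply: iff_trans h _; rewrite -ut -!map_tuple_comp.
  rewrite (_ : map_tuple (g \o val) u = map_tuple (val \o f) u)//.
  by apply: eq_from_tnth => j; rewrite !tnth_map /= gE.
- apply/seteqP; split=> [y [x Ax <-]|y By].
    by rewrite (lft _ Ax) gE; apply: set_mem; exact: valP.
  have [h fK hK] := bf.
  pose y' : restriction B := exist (fun x => x \in B) y (mem_set By).
  exists (val (h y')); first by apply: set_mem; exact: valP.
  by rewrite gE hK.
Qed.

Lemma embeds_of_emb R S (A : set R) (f : S -> restriction A) :
  emb_on setT f -> embeds S (restriction A).
Proof.
move=> ef; exists (f @` setT).
apply: isomorphic_trans (isomorphic_img ef erefl).
exists (fun x => exist (fun x => x \in setT) x (mem_set Logic.I)); split.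
  by exists val => // x; exact: val_inj.
move=> i t; rewrite /rel_of/= -map_tuple_comp.
by rewrite (_ : map_tuple _ t = t)//; apply: eq_from_tnth => j; rewrite tnth_map.
Qed.

Lemma sibling_restriction R (A : set R) (f : R -> R) :
  emb_on setT f -> (forall x, A (f x)) -> sibling R (restriction A).
Proof.
move=> [injf relf] fA; split; first by exists A; exact: isomorphic_refl.
apply: (@embeds_of_emb R R A (lift_to fA)); split.
  by move=> x y _ _ /(congr1 val) /=; exact: injf.
move=> i t tT; rewrite relf// /rel_of/= -map_tuple_comp.
exact: iff_refl.
Qed.

End Isomorphisms.

(** * Monomorphic components as equivalence classes *)

(** Turns a finite subset of an image into the image of a finite set, so that
    quantifying over the one amounts to quantifying over the other. *)
Lemma fset_preimage (T U : choiceType) (f : T -> U) (A : set T)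
  (F : {fset U}) :
  [set` F] `<=` f @` A ->
  exists G : {fset T}, [set` G] `<=` A /\ (f @` G)%fset = F.
Proof.
elim/fset1U_rect: F => [_|u F _ IH uFA].
  by exists fset0; split=> [x|]; rewrite ?imfset0.
have [|G [GA <-]] := IH.
  by move=> x xF; apply: uFA => /=; rewrite in_fset1U; apply/orP; right.
have [|x Ax <-] := uFA u; first by rewrite /= in_fset1U eqxx.
exists (x |` G)%fset; split; last exact: imfsetU1.
by move=> z /=; rewrite in_fset1U => /orP[/eqP ->|/GA].
Qed.

Section Components.
Variables (I : Type) (ar : I -> nat).
Implicit Types R S T : structure ar.

Definition fiso R S (F : {fset R}) (G : {fset S}) : Prop :=
  isomorphic (restriction [set` F]) (restriction [set` G]).

Lemma fiso_refl R (F : {fset R}) : fiso F F.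
Proof. exact: isomorphic_refl. Qed.

Lemma fiso_sym R S (F : {fset R}) (G : {fset S}) : fiso F G -> fiso G F.
Proof. exact: isomorphic_sym. Qed.

Lemma fiso_trans R S T (G : {fset S}) (F : {fset R}) (H : {fset T}) :
  fiso F G -> fiso G H -> fiso F H.
Proof. exact: isomorphic_trans. Qed.

Lemma set_imfset R S (f : R -> S) (F : {fset R}) :
  f @` [set` F] = [set` (f @` F)%fset].
Proof.
apply/seteqP; split=> [y [x xF <-]|y /imfsetP[x xF ->]]; last by exists x.
exact: in_imfset.
Qed.

Lemma fiso_img R S (f : R -> S) (F : {fset R}) :
  emb_on [set` F] f -> fiso F (f @` F)%fset.
Proof. by move=> ef; apply: (isomorphic_img ef); exact: set_imfset. Qed.

Lemma fiso_emb_img R S (f : R -> S) (F : {fset R}) :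
  emb_on setT f -> fiso F (f @` F)%fset.
Proof. by move=> ef; apply: fiso_img; apply: emb_on_sub ef. Qed.

Lemma fiso_iso_img R S (f : R -> S) (F : {fset R}) :
  is_iso f -> fiso F (f @` F)%fset.
Proof. by move=> /is_iso_emb; exact: fiso_emb_img. Qed.

(** For [A = setT] this is the relation of lying in the same monomorphic
    component. A general [A] makes it the same relation for [restriction A],
    without leaving [R]; see [exch_emb]. *)
Definition exch R (A : set R) (x y : R) : Prop :=
  forall F : {fset R}, [set` F] `<=` A -> x \notin F -> y \notin F ->
    fiso (x |` F)%fset (y |` F)%fset.

Lemma exch_refl R (A : set R) x : exch A x x.
Proof. by move=> *; exact: fiso_refl. Qed.

Lemma exch_sym R (A : set R) x y : exch A x y -> exch A y x.
Proof. by move=> xy F FA yF xF; apply/fiso_sym/xy. Qed.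

Lemma exch_sub R (A B : set R) x y : A `<=` B -> exch B x y -> exch A x y.
Proof. by move=> AB xy F FA; apply: xy; exact: subset_trans AB. Qed.

(** When [y] lies in [F], neither hypothesis applies to [F] itself; but
    trading [y] for [z] in [y |` _], and then [x] for [y] in [z |` _], makes
    the trade of [x] for [z] as two trades. *)
Lemma exch_trans R (A : set R) x y z : A x -> A z ->
  exch A x y -> exch A y z -> exch A x z.
Proof.
move=> Ax Az xy yz F FA xF zF.
have [yF|yF] := boolP (y \in F); last first.
  by apply: fiso_trans (xy F FA xF yF) (yz F FA yF zF).
have [->|xNz] := eqVneq x z; first exact: fiso_refl.
have xNy : x != y by apply: contraNneq xF => ->.
have zNy : z != y by apply: contraNneq zF => ->.
rewrite -(fsetD1K yF); set G := (F `\ y)%fset.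
have [xG zG yG] : [/\ x \notin G, z \notin G & y \notin G].
  by rewrite !inE (negbTE xF) (negbTE zF) eqxx !andbF.
have GA w : A w -> [set` (w |` G)%fset] `<=` A.
  by move=> Aw u /=; rewrite !inE => /orP[/eqP ->|/andP[_ /FA]].
rewrite (fsetUCA [fset x]%fset) (fsetUCA [fset z]%fset).
apply: (@fiso_trans _ _ _ (z |` (x |` G))%fset).
  by apply: yz; rewrite ?in_fset1U ?negb_or ?[y == _]eq_sym ?[z == x]eq_sym
    ?xNy ?xNz//; exact: GA.
rewrite (fsetUCA [fset z]%fset).
by apply: xy; rewrite ?in_fset1U ?negb_or ?[y == _]eq_sym ?zNy ?xNz//; exact: GA.
Qed.

Lemma exch_emb S R (f : S -> R) x y :
  emb_on setT f -> exch setT x y <-> exch (range f) (f x) (f y).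
Proof.
move=> ef; have injf : injective f by move=> u v; apply: ef.1.
have lift (F : {fset S}) u : fiso (u |` F)%fset (f u |` (f @` F))%fset.
  by rewrite -imfsetU1; exact: fiso_emb_img.
have memf (F : {fset S}) u : (f u \in f @` F)%fset = (u \in F).
  exact: mem_imfset.
split=> xy F FA xF yF.
  have [G [_ GF]] := fset_preimage FA.
  move: xF yF; rewrite -GF !memf => xG yG.
  apply: fiso_trans (lift G y); apply: fiso_trans (xy G _ xG yG) => //.
  exact/fiso_sym/lift.
apply: fiso_trans (fiso_sym (lift F y)); apply: fiso_trans (lift F x) _.
apply: xy; rewrite ?memf// => u /= /imfsetP[v _ ->].
by exists v.
Qed.

Definition exch_class R (A : set R) (x : R) : set R :=
  [set y | A y /\ exch A x y].

Definition has_class_card S (n : nat) : Prop :=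
  exists x : S, exch_class setT x #= `I_n.

Lemma class_emb S R (f : S -> R) x :
  emb_on setT f -> f @` exch_class setT x = exch_class (range f) (f x).
Proof.
move=> ef; apply/seteqP; split=> [_ [y [_ xy] <-]|_ [[y _ <-] xy]].
  by split; [exists y | apply/exch_emb].
by exists y => //; split => //; apply/(exch_emb _ _ ef).
Qed.

Lemma has_class_card_emb S R (f : S -> R) n : emb_on setT f ->
  has_class_card S n <-> exists2 x, range f x & exch_class (range f) x #= `I_n.
Proof.
move=> ef; have card x : exch_class (range f) (f x) #= exch_class setT x.
  rewrite -class_emb//; apply: inj_card_eq => u v _ _; exact: ef.1.
split=> [[x xn]|[_ [x _ <-] xn]].
  by exists (f x); [exists x | rewrite (card_eql (card x))].
by exists x; rewrite -(card_eql (card x)).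
Qed.

Lemma has_class_card_restriction R (A : set R) n :
  has_class_card (restriction A) n <-> exists2 x, A x & exch_class A x #= `I_n.
Proof.
rewrite (has_class_card_emb _ (emb_on_val A)).
rewrite (_ : range val = A)//; apply/seteqP; split=> [_ [x _ <-]|x Ax].
  by apply: set_mem; exact: valP.
by exists (exist (fun x => x \in A) x (mem_set Ax)).
Qed.

Lemma has_class_card_iso S R n :
  isomorphic S R -> has_class_card S n -> has_class_card R n.
Proof.
move=> [f isof]; have /(has_class_card_emb n) -> := is_iso_emb isof.
have [g gf fg] := isof.1.
rewrite (_ : range f = setT); first by move=> [x _ xn]; exists x.
by apply/seteqP; split=> // y _; exists (g y).
Qed.

(** Trading the elements of [F] outside [G] one by one. *)
Lemma fiso_exchange R (F G : {fset R}) : #|` F| = #|` G| ->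
  (forall x y, x \in F -> x \notin G -> y \in G -> y \notin F ->
    exch setT x y) ->
  fiso F G.
Proof.
have [n] := ubnP #|` F `\` G|%fset; elim: n F => // n IH F nFG FG xy.
have [/eqP FG0|/fset0Pn[x]] := boolP (F `\` G == fset0)%fset.
  have/eqP -> : F == G; last exact: fiso_refl.
  by rewrite eqEfcard -fsetD_eq0 FG0 FG eqxx leqnn.
rewrite in_fsetD => /andP[xG xF].
have /fset0Pn[y] : (G `\` F != fset0)%fset.
  rewrite -cardfs_gt0; have := cardfsID G F; have := cardfsID F G.
  rewrite fsetIC FG => <- /eqP; rewrite eqn_add2l => /eqP <-.
  by rewrite cardfs_gt0; apply/fset0Pn; exists x; rewrite in_fsetD xG.
rewrite in_fsetD => /andP[yF yG].
have yFx : y \notin (F `\ x)%fset by rewrite in_fsetD1 (negbTE yF) andbF.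
apply: (@fiso_trans _ _ _ (y |` (F `\ x))%fset).
  by rewrite -{1}(fsetD1K xF); apply: xy; rewrite // in_fsetD1 eqxx.
apply: IH.
- rewrite -ltnS; apply: leq_trans nFG; apply: fproper_ltn_card.
  rewrite (_ : _ `\` G = F `\` G `\ x)%fset.
    by apply: fproperD1; rewrite in_fsetD xG.
  apply/fsetP => u; rewrite !inE.
  by have [->|] := eqVneq u y; rewrite ?yG ?(negbTE yF) /= ?andbF// andbCA.
- by rewrite cardfsU1 yFx -FG (cardfsD1 x F) xF.
- move=> u v; rewrite !inE => /orP[/eqP ->|/andP[ux uF]] uG vG.
    by rewrite yG in uG.
  rewrite negb_or negb_and negbK => /andP[vy /orP[/eqP vx|vF]].
    by move: xG; rewrite -vx vG.
  exact: xy.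
Qed.

Lemma monomorphic_part_class R (x : R) : monomorphic_part (exch_class setT x).
Proof.
move=> k A B Ak Bk AB.
have fA : finite_set A by apply/finite_setP; exists k.
have fB : finite_set B by apply/finite_setP; exists k.
rewrite -(fset_setK fA) -(fset_setK fB).
have sub u (C D : set R) : C `\` exch_class setT x = D `\` exch_class setT x ->
    C u -> ~ D u -> exch setT x u.
  move=> CD Cu Du; apply: contrapT => xu.
  by have [] : (D `\` exch_class setT x) u by rewrite -CD; split=> // -[].
apply: fiso_exchange; first by rewrite (card_fset_set Ak) (card_fset_set Bk).
move=> u v; rewrite !in_fset_set// => /set_mem Au /negP uB /set_mem Bv /negP vA.
apply: (@exch_trans _ _ _ x) => //.
  by apply/exch_sym/(sub _ A B) => // Bu; exact: uB (mem_set Bu).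
by apply/(sub _ B A) => // Av; exact: vA (mem_set Av).
Qed.

(** A monomorphic part consists of exchangeable points, as [x |` F] and [y |`
    F] agree outside a part containing [x] and [y]; so it is contained in a
    class, and classes are parts. *)
Lemma monomorphic_component_class R (C : set R) x :
  monomorphic_component C -> C x -> C = exch_class setT x.
Proof.
move=> [Cpart Cmax] Cx; apply/esym/Cmax; first exact: monomorphic_part_class.
move=> y Cy; split=> // F _ xF yF.
apply: (Cpart #|` x |` F|%fset); try exact/card_eq_fsetP.
  by apply/card_eq_fsetP; rewrite !cardfsU1 xF yF.
by apply/seteqP; split=> u [/fset1UP[->//|uF] uC];
  split=> //; apply/fset1UP; right.
Qed.

End Components.

(** * Oligomorphic automorphism groups *)

(** A finite image has a finite set of representatives in the domain: this is
    how finiteness of a set of orbits is used. *)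
Lemma finite_image_reps (T U : Type) (f : T -> U) (A : set T) :
  finite_set (f @` A) ->
  exists D : set T, [/\ finite_set D, D `<=` A &
    forall a, A a -> exists2 d, D d & f d = f a].
Proof.
move=> ffA; have h (u : U) : exists d : option T,
    (f @` A) u -> exists2 a, d = Some a & A a /\ f a = u.
  have [[a Aa <-]|nu] := pselect ((f @` A) u); last by exists None => /nu.
  by exists (Some a) => _; exists a.
have [g gP] := choice h.
exists (Some @^-1` (g @` (f @` A))); split.
- by apply: finite_preimage; [move=> x y _ _ [] | exact: finite_image].
- by move=> d /= [u fAu gu]; have [a] := gP u fAu; rewrite gu => -[->] [].
- move=> a Aa; have [|d gd [Ad dfa]] := gP (f a); first by exists a.
  by exists d => //=; exists (f a) => //; exists a.
Qed.

Section Oligomorphic.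
Variables (I : Type) (ar : I -> nat) (R : structure ar).

Definition witness_bound N : Prop := forall x y : R, ~ exch setT x y ->
  exists F : {fset R}, [/\ (#|` F| <= N)%N, x \notin F, y \notin F &
    ~ fiso (x |` F)%fset (y |` F)%fset].

Hypothesis Roligo : oligomorphic (Aut R).

(** One finite set [Z] containing, up to automorphism, every finite set of
    bounded size; it is a union of representatives of the orbits. *)
Lemma oligomorphic_fset n : exists Z : {fset R}, forall F : {fset R},
  (#|` F| <= n)%N -> exists g : R -> R, is_iso g /\ (g @` F `<=` Z)%fset.
Proof.
have exact_size k : exists Z : {fset R}, forall F : {fset R},
    #|` F| = k -> exists g : R -> R, is_iso g /\ (g @` F `<=` Z)%fset.
  have [D [fD Dk Dorb]] := finite_image_reps (Roligo k).
  have fU : finite_set (\bigcup_(A in D) A).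
    by apply: bigcup_finite => // A /Dk /= Ak; apply/finite_setP; exists k.
  exists (fset_set (\bigcup_(A in D) A)) => F Fk.
  have [|A DA AF] := Dorb [set` F]; first exact/card_eq_fsetP.
  have : orbit_of_set (Aut R) [set` F] [set` F].
    by exists id; [exact: is_iso_id | rewrite image_id].
  rewrite -AF => -[h hiso hA]; have [g [giso hg gh]] := is_iso_inv hiso.
  exists g; split=> //; apply/fsubsetP => _ /imfsetP[/= x xF ->].
  have : (h @` A) x by rewrite hA.
  move=> [a Aa <-]; rewrite hg in_fset_set//; apply/mem_set.
  by exists A.
elim: n => [|n [Z ZP]].
  have [Z ZP] := exact_size 0; exists Z => F; rewrite leqn0 => /eqP.
  exact: ZP.
have [Z' ZP'] := exact_size n.+1; exists (Z `|` Z')%fset => F.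
rewrite leq_eqVlt => /orP[/eqP /ZP'|/ZP] [g [giso gZ]];
  exists g; split=> //; apply: fsubset_trans gZ _.
  exact: fsubsetUr.
exact: fsubsetUl.
Qed.

(** Automorphisms moving [e |` F] into a fixed finite set [Z] take finitely
    many values on [F] and at [e]; two points whose automorphisms take the same
    values are exchanged by the stabilizer of [F]. *)
Lemma oligomorphic_stabilizer (F : {fset R}) : exists D : {fset R},
  forall e, exists g : R -> R,
    [/\ is_iso g, forall x, x \in F -> g x = x & g e \in D].
Proof.
have [Z ZP] := oligomorphic_fset #|` F|.+1.
have hP e : exists h : R -> R, is_iso h /\ (h @` (e |` F) `<=` Z)%fset.
  by apply: ZP; rewrite cardfsU1; case: (_ \notin _).
have [h hh] := choice hP.
pose code e := (h e e, [fset (x, h e x) | x in F]%fset).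
have fin : finite_set (code @` setT).
  apply: (@sub_finite_set _ _
    [set` (Z `*` fpowerset (F `*` Z))%fset]); last exact: finite_fset.
  move=> _ [e _ <-] /=; have hZ x : x \in (e |` F)%fset -> h e x \in Z.
    by move=> xF; apply: (fsubsetP (hh e).2); exact: in_imfset.
  rewrite in_fsetM /= hZ ?fset1U1//= fpowersetE; apply/fsubsetP.
  move=> _ /imfsetP[/= x xF ->].
  by rewrite in_fsetM /= xF hZ// fset1Ur.
have [D [fD _ DP]] := finite_image_reps fin.
exists (fset_set D) => e; have [//|d Dd [ed /fsetP eF]] := DP e.
have [g [giso hg gh]] := is_iso_inv (hh d).1.
exists (g \o h e); split; first exact: is_iso_comp (hh e).1 giso.
  move=> x xF /=; have : (x, h e x) \in [fset (x, h d x) | x in F]%fset.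
    by rewrite eF; apply/imfsetP; exists x.
  by move=> /imfsetP[/= y _ [<- ->]].
by rewrite /= -ed hg in_fset_set//; exact: mem_set.
Qed.

(** Koenig's lemma: a partial choice of values is good if every finite set of
    conditions has a solution extending it. A good choice extends to any further
    point [j]: up to the stabilizer of the values already chosen there are
    finitely many candidates for the value at [j], and if each of them violated
    some finite set of conditions, no candidate would satisfy the union of these
    sets. *)
Lemma compactness (J : choiceType) (c : J -> nat)
  (P : {fset J} -> (J -> R) -> Prop) :
  injective c ->
  (forall K x y, (forall j, j \in K -> x j = y j) -> P K x -> P K y) ->
  (forall K x (g : R -> R), is_iso g -> P K x -> P K (g \o x)) ->
  (forall (K K' : {fset J}) x, (K `<=` K')%fset -> P K' x -> P K x) ->
  (forall K, exists x, P K x) ->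
  exists x, forall K, P K x.
Proof.
move=> injc Ploc Pinv Pmono Psat.
pose agree n (x y : J -> R) := forall j, (c j < n)%N -> x j = y j.
pose good n x := forall K, exists y, agree n x y /\ P K y.
have step (s : {x : nat * (J -> R) | good x.1 x.2}) :
    exists s' : {x : nat * (J -> R) | good x.1 x.2},
    (sval s').1 = (sval s).1.+1 /\
    agree (sval s).1 (sval s).2 (sval s').2.
  case: s => -[n x] /= gx.
  have [[j cj]|nj] := pselect (exists j, c j = n); last first.
    have gx' : good n.+1 x.
      move=> K; have [y [xy Py]] := gx K; exists y; split=> // i.
      rewrite ltnS leq_eqVlt => /orP[/eqP cin|]; last exact: xy.
      by case: nj; exists i.
    by exists (exist _ (n.+1, x) gx').
  pose upd e : J -> R := fun i => if i == j then e else x i.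
  have [[e ge]|ne] := pselect (exists e, good n.+1 (upd e)).
    exists (exist _ (n.+1, upd e) ge); split=> //= i ci.
    by rewrite /upd; case: eqP => // ij; move: ci; rewrite ij cj ltnn.
  exfalso.
  have finn : finite_set [set i | (c i < n)%N].
    apply: (@finite_preimage _ _ `I_n c); last exact: finite_II.
    by move=> u v _ _ /injc.
  have [D DP] := oligomorphic_stabilizer (fset_set (x @` [set i | (c i < n)%N])).
  have bad e : exists K, forall y, agree n.+1 (upd e) y -> ~ P K y.
    apply: contrapT => nK; apply: ne; exists e => K.
    apply: contrapT => nex; apply: nK; exists K => y ey Py.
    by apply: nex; exists y.
  have [Kb KbP] := choice bad.
  have [y [xy Py]] := gx (\bigcup_(e <- D) Kb e)%fset.
  have [g [giso gfix gD]] := DP (y j).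
  apply: (KbP (g (y j)) (g \o y)).
    move=> i; rewrite ltnS leq_eqVlt /upd.
    have [->//|ij] := eqVneq i j.
    rewrite -cj (inj_eq injc) (negbTE ij) /= => ci.
    rewrite cj in ci; rewrite -(xy i ci) gfix// in_fset_set.
      by apply/mem_set; exists i.
    exact: finite_image.
  apply: Pmono (Pinv _ _ _ giso Py).
  exact: (@bigfcup_sup _ _ _ _ predT Kb).
have [next nextP] := choice step.
have [x0 Px0] := Psat fset0.
have g0 : good 0 x0 by move=> K; have [y Py] := Psat K; exists y.
pose s n := iter n next (exist _ (0, x0) g0).
have s1 n : (sval (s n)).1 = n.
  by elim: n => //= n IH; rewrite (nextP (s n)).1 IH.
have coh n m j : (n <= m)%N -> (c j < n)%N ->
    (sval (s n)).2 j = (sval (s m)).2 j.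
  move=> /subnKC <-; elim: (m - n) => [|k IH] cj; first by rewrite addn0.
  rewrite addnS /= IH//; apply: (nextP _).2.
  by rewrite s1; apply: leq_trans cj (leq_addr _ _).
exists (fun j => (sval (s (c j).+1)).2 j) => K.
pose n := \max_(j <- K) (c j).+1.
have gn : good n (sval (s n)).2 by rewrite -{1}(s1 n); exact: svalP (s n).
have [y [ny Py]] := gn K; apply: Ploc Py => j jK.
have cn : (c j < n)%N.
  exact: (@leq_bigmax_seq _ (enum_fset K) xpredT (fun j => (c j).+1) j jK).
by rewrite -ny// (coh (c j).+1 n).
Qed.

Lemma range_iso (g : R -> R) : is_iso g -> range g = setT.
Proof.
move=> [[h _ gh] _]; apply/seteqP; split=> // z _; by exists (h z).
Qed.

Lemma exch_aut (g : R -> R) x y :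
  is_iso g -> exch setT (g x) (g y) <-> exch setT x y.
Proof.
by move=> giso; rewrite (exch_emb x y (is_iso_emb giso)) range_iso.
Qed.

Lemma class_aut (g : R -> R) x :
  is_iso g -> exch_class setT (g x) = g @` exch_class setT x.
Proof.
by move=> giso; rewrite (class_emb _ (is_iso_emb giso)) range_iso.
Qed.

(** Up to automorphism there are finitely many pairs of points, so an
    invariant natural number attached to pairs can be chosen among finitely
    many values. *)
Lemma aut_invariant_bounded (Q : R -> R -> nat -> Prop) :
  (forall g x y n, is_iso g -> Q (g x) (g y) n -> Q x y n) ->
  exists N, forall x y n, Q x y n -> exists2 m, (m <= N)%N & Q x y m.
Proof.
move=> Qinv; have [Z ZP] := oligomorphic_fset 2.
have least (u : R * R) : exists n, forall m, Q u.1 u.2 m -> Q u.1 u.2 n.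
  have [[n Qn]|nQ] := pselect (exists n, Q u.1 u.2 n); first by exists n.
  by exists 0 => m Qm; case: nQ; exists m.
have [b bP] := choice least.
exists (\max_(u <- (Z `*` Z)%fset) b u) => x y n Qn.
have [|g [giso gZ]] := ZP [fset x; y]%fset.
  by rewrite cardfs2; case: (_ != _).
have [h [hiso gh hg]] := is_iso_inv giso.
exists (b (g x, g y)).
  apply: (@leq_bigmax_seq _ (enum_fset _) xpredT b) => //.
  by rewrite in_fsetM /= !(fsubsetP gZ)//; apply: in_imfset;
    rewrite !inE eqxx ?orbT.
apply: (Qinv g) => //; apply: (bP (g x, g y) n) => /=.
by apply: (Qinv h) => //; rewrite !gh.
Qed.

Lemma witness_bound_exists : exists N, witness_bound N.
Proof.
pose Q (x y : R) n := exists F : {fset R},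
    [/\ #|` F| = n, x \notin F, y \notin F &
        ~ fiso (x |` F)%fset (y |` F)%fset].
have [|N NP] := @aut_invariant_bounded Q.
  move=> g x y n giso [F [Fn xF yF xy]].
  have [h [hiso gh hg]] := is_iso_inv giso.
  have injh : injective h by exact: can_inj hg.
  exists (h @` F)%fset; rewrite -[x]gh -[y]gh !(mem_imfset _ _ injh); split=> //.
    by rewrite card_imfset.
  rewrite -!imfsetU1 => xy'; apply: xy.
  apply: fiso_trans (fiso_iso_img _ hiso) _; apply: fiso_trans xy' _.
  exact/fiso_sym/fiso_iso_img.
exists N => x y nxy.
have [F [xF yF FP]] : exists F : {fset R},
    [/\ x \notin F, y \notin F & ~ fiso (x |` F)%fset (y |` F)%fset].
  apply: contrapT => nF; apply: nxy => F _ xF yF.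
  by apply: contrapT => xy; apply: nF; exists F.
have [|m mN [G [Gm xG yG GP]]] := NP x y #|` F|; first by exists F.
by exists G; rewrite Gm.
Qed.

Lemma finite_class_bounded : exists m, forall (x : R) n,
  exch_class setT x #= `I_n -> (n <= m)%N.
Proof.
have [|m mP] := @aut_invariant_bounded (fun x _ n => exch_class setT x #= `I_n).
  move=> g x _ n giso; rewrite class_aut// (card_eql (inj_card_eq _))//.
  by move=> u v _ _; exact: (is_iso_emb giso).1.
exists m => x n xn; have [k km xk] := mP x x n xn.
rewrite (leq_trans _ km)// -card_le_II -(card_le_eql xn) -(card_le_eqr xk).
exact: card_lexx.
Qed.

End Oligomorphic.

(** * Restrictions that keep the components apart *)

Section Replaceable.
Variables (I : Type) (ar : I -> nat) (R : structure ar).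
Implicit Types (A : set R) (F G H V W : {fset R}).

(** Points outside [A] can be traded for points of [A] over finite sets. [z']
    works for all subsets [G] of [H] at once so that one trade serves two sets
    that differ in a point of [H]. *)
Definition replaceable A n : Prop :=
  forall H z, ~ A z -> z \notin H -> (#|` H| <= n)%N ->
  exists z', [/\ A z', z' \notin H &
    forall G, (G `<=` H)%fset -> fiso (z |` G)%fset (z' |` G)%fset].

(** [W] is a set of points to be kept fixed: the lemma is used with two points
    [x], [y] as [W] and a witness of their inexchangeability as [F], and with
    empty [W] to push a finite set into [A]. *)
Lemma replaceable_move A n W F : replaceable A n ->
  (forall x, x \in W -> x \notin F) -> (#|` W `|` F|%fset <= n.+1)%N ->
  exists F', [/\ [set` F'] `<=` A, forall x, x \in W -> x \notin F' &
    forall V, (V `<=` W)%fset -> fiso (V `|` F)%fset (V `|` F')%fset].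
Proof.
move=> Arep; pose bad F := [fset x in F | ~~ `[< A x >]]%fset.
have [k] := ubnP #|` bad F|; elim: k F => // k IH F Fk WF Fn.
have [/eqP bad0|/fset0Pn[z]] := boolP (bad F == fset0)%fset.
  exists F; split=> // [x /= xF|V _]; last exact: fiso_refl.
  apply: contrapT => nAx; have : x \in bad F.
    by rewrite !inE /= xF; apply/asboolPn.
  by rewrite bad0.
rewrite !inE /= => /andP[zF /asboolPn nAz].
have zW : z \notin W by apply: contraL zF => /WF.
pose H := (W `|` F `\ z)%fset.
have zH : z \notin H by rewrite !inE negb_or zW eqxx.
have WFE : (W `|` F = z |` H)%fset by rewrite fsetUCA fsetD1K.
have [|z' [Az' z'H z'P]] := Arep H z nAz zH.
  by rewrite -ltnS; apply: leq_trans Fn; rewrite WFE cardfsU1 zH.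
have [| | |F' [F'A WF' F'P]] := IH (z' |` F `\ z)%fset.
- rewrite -ltnS; apply: leq_trans Fk; rewrite ltnS; apply: fproper_ltn_card.
  apply: (@fsub_proper_trans _ (bad F `\ z)%fset); last first.
    by apply: fproperD1; rewrite !inE /= zF; apply/asboolPn.
  apply/fsubsetP => x; rewrite !inE /= => /andP[/orP[/eqP ->|]].
    by move=> /asboolPn.
  by move=> /andP[-> ->].
- move=> x xW; rewrite !inE negb_or (negbTE (WF x xW)) andbF andbT.
  by apply: contraNneq z'H => <-; rewrite !inE xW.
- rewrite fsetUCA cardfsU1 z'H; apply: leq_trans Fn.
  by rewrite WFE cardfsU1 zH.
exists F'; split=> // V VW; apply: fiso_trans (F'P V VW).
rewrite -{1}(fsetD1K zF) !(fsetUCA V); apply: z'P.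
exact: fsetSU.
Qed.

(** A witness of the inexchangeability of [x] and [y] has at most [N] points,
    and it can be moved into [A] with [x] and [y] fixed. *)
Lemma exch_replaceable A N x y :
  witness_bound R N ->
  replaceable A N.+1 -> exch A x y -> exch setT x y.
Proof.
move=> NP Arep xy; apply: contrapT => /NP[F [FN xF yF]]; apply.
have [| |F' [F'A WF' F'P]] := @replaceable_move A N.+1 [fset x; y]%fset F Arep.
- by move=> z; rewrite !inE => /orP[] /eqP ->.
- rewrite cardfsU; apply: leq_trans (leq_subr _ _) _.
  by rewrite -addn2 addnC leq_add// cardfs2; case: (_ != _).
have xs : ([fset x] `<=` [fset x; y])%fset by rewrite fsub1set !inE eqxx.
have ys : ([fset y] `<=` [fset x; y])%fset by rewrite fsub1set !inE eqxx orbT.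
apply: fiso_trans (F'P _ xs) _; apply: fiso_trans _ (fiso_sym (F'P _ ys)).
by apply: xy => //; apply: WF'; rewrite !inE eqxx ?orbT.
Qed.

(** Restricting to [A] merges no two classes; it splits none in any case. *)
Lemma class_replaceable A N x :
  witness_bound R N ->
  replaceable A N.+1 -> exch_class A x = A `&` exch_class setT x.
Proof.
move=> NP Arep; apply/seteqP; split=> y [Ay].
  by move=> xy; split=> //; split=> //; exact: exch_replaceable NP Arep xy.
by move=> [_ xy]; split=> //; apply: exch_sub xy.
Qed.

End Replaceable.

(** * Sequences of components *)

Section Sequences.
Variables (I : Type) (ar : I -> nat) (R : structure ar).

(** The empty set has to be excluded: it is not a maximal part once some other
    component is nonempty. *)
Lemma components_sequence (Q : set R -> Prop) :
  infinite_set [set C : set R | monomorphic_component C /\ Q C] ->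
  exists d : nat -> R, (forall j, Q (exch_class setT (d j))) /\
    forall i j, i <> j -> ~ exch setT (d i) (d j).
Proof.
move=> /infiniteP/ppcard_leP[f].
have fP i : monomorphic_component (f i) /\ Q (f i) by exact: ('funS_f).
have injf i j : f i = f j -> i = j by move=> ?; apply: ('inj_f); rewrite ?inE.
have f0 i x : f i x -> f i = exch_class setT x.
  by move=> fix_; apply: monomorphic_component_class fix_; exact: (fP i).1.
have fN0 i : exists x, f i x.
  apply: contrapT => nfi; have fi0 : f i = set0.
    by apply/seteqP; split=> // x fix_; apply: nfi; exists x.
  have [[x fx]|nfi'] := pselect (exists x, f i.+1 x).
    have : exch_class setT x x by split=> //; exact: exch_refl.
    rewrite ((fP i).1.2 (exch_class setT x)) ?fi0//.
    exact: monomorphic_part_class.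
  have /injf : f i = f i.+1.
    rewrite fi0; apply/seteqP; split=> // x fx; apply: nfi'; by exists x.
  by move=> /eqP; rewrite eqn_leq ltnn andbF.
have [d dP] := choice fN0.
exists d; split=> [j|i j ij dij].
  by rewrite -(f0 _ _ (dP j)); exact: (fP j).2.
apply: ij; apply: injf; rewrite (f0 _ _ (dP i)); apply/esym.
by apply: monomorphic_component_class (fP j).1 _; rewrite (f0 _ _ (dP j));
  split=> //; exact: exch_sym.
Qed.

(** Each point of [F] is exchangeable with at most one [d j]. *)
Lemma sequence_avoids (d : nat -> R) (F : {fset R}) :
  (forall i j, i <> j -> ~ exch setT (d i) (d j)) ->
  exists M, forall j x, (M <= j)%N -> x \in F -> ~ exch setT x (d j).
Proof.
move=> dP; elim/fset1U_rect: F => [|x F _ [M MP]]; first by exists 0.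
have [[i xi]|nx] := pselect (exists i, exch setT x (d i)).
  exists (maxn M i.+1) => j y; rewrite geq_max => /andP[Mj ij].
  rewrite in_fset1U => /orP[/eqP -> xj|]; last exact: MP.
  apply: (dP i j); first by move=> ij'; rewrite ij' ltnn in ij.
  by apply: (@exch_trans _ _ _ _ _ x) => //; exact: exch_sym.
exists M => j y Mj; rewrite in_fset1U => /orP[/eqP -> xj|]; last exact: MP.
by apply: nx; exists j.
Qed.

Lemma emb_of_finite (phi : R -> R) :
  (forall F : {fset R}, exists g : R -> R, emb_on [set` F] g /\
    forall x, x \in F -> g x = phi x) ->
  emb_on setT phi.
Proof.
move=> phiP; split=> [x y _ _ xy|i t _].
  have [g [[ginj _] gphi]] := phiP [fset x; y]%fset.
  by apply: ginj; rewrite /= ?inE ?eqxx ?orbT// !gphi// !inE eqxx ?orbT.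
have [g [eg gphi]] := phiP [fset x in tval t]%fset.
have := emb_on_eq gphi eg; move=> [_ relphi]; apply: relphi => j /=.
by rewrite inE /= mem_tnth.
Qed.

End Sequences.

(** * Continuum many siblings *)

Lemma fset_inl (T : choiceType) (J : countType) (K : {fset (T + J)%type}) :
  exists F : {fset T}, forall r, inl r \in K -> r \in F.
Proof.
exists (\bigcup_(u <- K) if u is inl r then [fset r] else fset0)%fset.
by move=> r rK; apply/bigfcupP; exists (inl r); rewrite ?rK ?inE.
Qed.

Lemma infinite_set_fset_eq (T : choiceType) (A : set T) n : infinite_set A ->
  exists F : {fset T}, [set` F] `<=` A /\ #|` F| = n.
Proof.
move=> /(infinite_set_fset n)[F FA nF].
have ut : uniq (take n F) by rewrite take_uniq.
exists [fset x in take n F]%fset; split.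
  by move=> x /=; rewrite inE /= => /mem_take xF; exact: FA.
by rewrite card_fseq undup_id// size_takel.
Qed.

Section Continuum.
Variables (I : Type) (ar : I -> nat) (R : structure ar).
Hypotheses (Rcount : countable [set: R]) (Roligo : oligomorphic (Aut R)).

Lemma countable_sum_code (J : countType) :
  exists c : (R + J)%type -> nat, injective c.
Proof.
have /countable_injP[c injc] := Rcount.
exists (fun u => choice.pickle
  (match u with inl r => inl (c r) | inr j => inr j end : (nat + J)%type)).
move=> [r|j] [r'|j'] /(pcan_inj choice.pickleK) // => -[].
  by move=> /injc -> //; rewrite inE.
by move=> ->.
Qed.

(** Compactness for a map on [R + nat], whose values on the left are to be
    [phi] and on the right [d]. A finite set of conditions only speaks of
    finitely many points of [R], so the identity and a tail of [d0] satisfy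
    it. *)
Lemma selfembedding_off_classes (d0 : nat -> R) :
  (forall j, infinite_set (exch_class setT (d0 j))) ->
  (forall i j, i <> j -> ~ exch setT (d0 i) (d0 j)) ->
  exists (phi : R -> R) (d : nat -> R), [/\ emb_on setT phi,
    forall j, infinite_set (exch_class setT (d j)),
    forall r j, ~ exch setT (phi r) (d j) &
    forall i j, i <> j -> ~ exch setT (d i) (d j)].
Proof.
move=> d0inf d0P; have [c injc] := countable_sum_code nat.
pose P (K : {fset (R + nat)%type}) (x : (R + nat)%type -> R) :=
  [/\ exists g : R -> R, is_iso g /\ forall r, inl r \in K -> g r = x (inl r),
      forall j, inr j \in K -> infinite_set (exch_class setT (x (inr j))),
      forall r j, inl r \in K -> inr j \in K ->
        ~ exch setT (x (inl r)) (x (inr j)) &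
      forall i j, inr i \in K -> inr j \in K -> i <> j ->
        ~ exch setT (x (inr i)) (x (inr j))].
have [| | | |x xP] := compactness Roligo (P := P) injc.
- move=> K x y xy [[g [giso gx]] xinf xrj xij]; split.
  + by exists g; split=> // r rK; rewrite gx// xy.
  + by move=> j jK; rewrite -xy//; exact: xinf.
  + by move=> r j rK jK; rewrite -!xy//; exact: xrj.
  + by move=> i j iK jK; rewrite -!xy//; exact: xij.
- move=> K x h hiso [[g [giso gx]] xinf xrj xij]; split.
  + exists (h \o g); split; first exact: is_iso_comp.
    by move=> r rK /=; rewrite gx.
  + move=> j jK; rewrite /= class_aut// => fin; apply: (xinf j jK).
    rewrite -(eq_finite_set (inj_card_eq (f := h) _))// => u v _ _.
    exact: (is_iso_emb hiso).1.
  + by move=> r j rK jK /(exch_aut _ _ hiso); exact: xrj.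
  + by move=> i j iK jK ij /(exch_aut _ _ hiso); exact: xij.
- move=> K K' x /fsubsetP KK' [[g [giso gx]] xinf xrj xij]; split.
  + by exists g; split=> // r /KK'; exact: gx.
  + by move=> j /KK'; exact: xinf.
  + by move=> r j /KK' rK /KK'; exact: xrj.
  + by move=> i j /KK' iK /KK'; exact: xij.
- move=> K.
  have [F FP] := fset_inl K.
  have [M MP] := sequence_avoids F d0P.
  exists (fun u => match u with inl r => r | inr j => d0 (M + j)%N end); split.
  + by exists id; split=> //; exact: is_iso_id.
  + by move=> j _; exact: d0inf.
  + by move=> r j /FP rF _; apply: MP => //; exact: leq_addr.
  + by move=> i j _ _ ij; apply: d0P => /addnI.
exists (x \o inl), (x \o inr); split.
- apply: emb_of_finite => F.
  have [[g [giso gx]] _ _ _] := xP (inl @` F)%fset; exists g; split.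
    by apply: emb_on_sub (is_iso_emb giso).
  by move=> r rF; apply: gx; apply: in_imfset.
- by move=> j; have [_ + _ _] := xP [fset inr j]%fset; apply; rewrite inE.
- move=> r j; have [_ _ + _] := xP [fset inl r; inr j]%fset.
  by apply; rewrite !inE eqxx ?orbT.
- move=> i j; have [_ _ _] := xP [fset inr i; inr j]%fset.
  by apply; rewrite !inE eqxx ?orbT.
Qed.

Lemma sib_sub_subsets : sib R #<= [set: set nat].
Proof.
have /countable_injP[c injc] := Rcount.
have sub : sib R `<=` (fun A : set R => iso_class (restriction A)) @` setT.
  move=> _ [S [[A SA] _] <-]; exists A => //.
  by apply/esym; exact: iso_class_eq.
apply: card_le_trans (subset_card_le sub) _.
apply: card_le_trans (card_image_le _ _) _.
have injim : {in [set: set R] &, injective (fun A : set R => c @` A)}.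
  move=> A B _ _ AB; apply/seteqP; split=> x Ax.
    have : (c @` B) (c x) by rewrite -AB; exists x.
    by move=> [y By /injc <-] //; rewrite inE.
  have : (c @` A) (c x) by rewrite AB; exists x.
  by move=> [y By /injc <-] //; rewrite inE.
have := inj_card_eq injim; rewrite card_eq_sym => /card_eqPle[h _].
by apply: card_le_trans h _; exact: subset_card_le.
Qed.

(** For [j] in [X], the class of [d j] is cut down to a set [B j] with [k + j]
    points. The number [k] exceeds the sizes of all finite classes of [R], so
    a class of size [k + j] reveals that [j] is in [X]. *)
Lemma shrunk_siblings (d0 : nat -> R) :
  (forall j, infinite_set (exch_class setT (d0 j))) ->
  (forall i j, i <> j -> ~ exch setT (d0 i) (d0 j)) ->
  exists (S : set nat -> set R) (k : nat), forall X,
    sibling R (restriction (S X)) /\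
    forall j, has_class_card (restriction (S X)) (k + j)%N <-> X j.
Proof.
move=> d0inf d0P.
have [phi [d [ephi dinf phid dP]]] := selfembedding_off_classes d0inf d0P.
have [N NP] := witness_bound_exists Roligo.
have [m mP] := finite_class_bounded Roligo.
(* More than [N + 1] points, so that one of them avoids any set [H] of that
   size; more than [m] points, to differ from the finite classes of [R]. *)
pose k := (N + m).+3.
have BP j : exists B : {fset R},
    [set` B] `<=` exch_class setT (d j) /\ #|` B| = (k + j)%N.
  exact: infinite_set_fset_eq.
have [B {}BP] := choice BP.
pose S (X : set nat) : set R :=
  [set r | forall j, X j -> exch setT (d j) r -> r \in B j].
have SB X j : X j -> [set` B j] `<=` S X.
  move=> Xj r /= rB i Xi dir; have [->|/eqP ij] := eqVneq i j.
    exact: rB.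
  case: (dP i j ij); apply: exch_trans dir _ => //; apply: exch_sym.
  exact: ((BP j).1 r rB).2.
have rep X : replaceable (S X) N.+1.
  move=> H z nSz zH HN.
  have [j [Xj [djz zB]]] : exists j, X j /\ (exch setT (d j) z /\ z \notin B j).
    apply: contrapT => nj; apply: nSz => j Xj djz.
    by apply: contrapT => /negP zB; apply: nj; exists j.
  have /fset0Pn[z'] : (B j `\` H != fset0)%fset.
    rewrite -cardfs_gt0 cardfsD subn_gt0.
    apply: leq_ltn_trans (fsubset_leq_card (fsubsetIr _ _)) _.
    by apply: leq_ltn_trans HN _; rewrite (BP j).2 /k; lia.
  rewrite in_fsetD => /andP[z'H z'B]; exists z'; split=> //.
    exact: (SB X j Xj).
  move=> G /fsubsetP GH; have zz' : exch setT z z'.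
    apply: (@exch_trans _ _ _ _ _ (d j)) => //; first exact: exch_sym.
    exact: ((BP j).1 z' z'B).2.
  by apply: zz' => //; [apply: contra zH|apply: contra z'H]; exact: GH.
exists S, k => X; split.
  apply: (sibling_restriction ephi) => r j Xj dr.
  by case: (phid r j); exact: exch_sym.
move=> j; rewrite has_class_card_restriction.
have classE x := class_replaceable x NP (rep X).
have small i x : X i -> exch setT (d i) x -> exch_class (S X) x = [set` B i].
  move=> Xi dix; rewrite classE; apply/seteqP; split=> y.
    by move=> [Sy [_ xy]]; apply: Sy => //; exact: exch_trans xy.
  move=> /= yB; split; first exact: (SB X i).
  split=> //; apply: (@exch_trans _ _ _ _ _ (d i)) => //; first exact: exch_sym.
  exact: ((BP i).1 y yB).2.
have kj0 : (0 < k + j)%N by rewrite /k; lia.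
split=> [[x Sx xk]|Xj].
  have [[i [Xi dix]]|ni] := pselect (exists i, X i /\ exch setT (d i) x).
    have Bi : #|` B i| = (k + j)%N by apply/card_eq_fsetP; rewrite -(small i x).
    by move: Bi; rewrite (BP i).2 => /addnI <-.
  have xE : exch_class (S X) x = exch_class setT x.
    rewrite classE; apply/setIidPr => y [_ xy] i Xi diy.
    case: ni; exists i; split=> //.
    by apply: (@exch_trans _ _ _ _ _ y) => //; exact: exch_sym.
  by have := mP x (k + j)%N; rewrite -xE => /(_ xk); rewrite /k; lia.
have [r rB] : exists r, r \in B j.
  by apply/fset0Pn; rewrite -cardfs_gt0 (BP j).2.
exists r; first exact: (SB X j).
rewrite (small j)//; first by apply/card_eq_fsetP; exact: (BP j).2.
exact: ((BP j).1 r rB).2.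
Qed.

(** [X] is recovered from the sizes of the classes of the restriction to [S
    X]. *)
Lemma sib_continuum (d0 : nat -> R) :
  (forall j, infinite_set (exch_class setT (d0 j))) ->
  (forall i j, i <> j -> ~ exch setT (d0 i) (d0 j)) ->
  sib R #= [set: set nat].
Proof.
move=> d0inf d0P; have [S [k SP]] := shrunk_siblings d0inf d0P.
apply/card_eqPle; split; first exact: sib_sub_subsets.
pose f X := iso_class (restriction (S X)).
have injf : {in [set: set nat] &, injective f}.
  have sub X Y : f X = f Y -> X `<=` Y.
    move=> /iso_class_inj XY j /((SP X).2 j) Xj.
    by apply/((SP Y).2 j); apply: has_class_card_iso XY Xj.
  by move=> X Y _ _ fXY; apply/seteqP; split; apply: sub.
have := inj_card_eq injf; rewrite card_eq_sym => /card_eqPle[h _].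
apply: card_le_trans h _; apply: subset_card_le => _ [X _ <-].
by exists (restriction (S X)) => //; exact: (SP X).1.
Qed.

End Continuum.

(** * Limit types along a sequence of components *)

Section LimitTypes.
Variables (I : Type) (ar : I -> nat) (R : structure ar).
Hypotheses (Roligo : oligomorphic (Aut R)).
Variables (d : nat -> R) (V : set_system nat).
Hypotheses (dP : forall i j, i <> j -> ~ exch setT (d i) (d j))
  (Vultra : UltraFilter V) (Voo : eventually `<=` V).
Implicit Types (F G H A B : {fset R}).

Lemma ae_all (X : choiceType) (D : {fset X}) (Q : X -> nat -> Prop) :
  (forall u, u \in D -> V [set j | Q u j]) ->
  V [set j | forall u, u \in D -> Q u j].
Proof.
by move=> VQ; apply: filterS (filter_bigI _ VQ) => j Qj u /Qj.
Qed.

Lemma ae_and (P Q : set nat) : V P -> V Q -> V (P `&` Q).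
Proof. exact: filterI. Qed.

Lemma ae_ex (P : set nat) : V P -> exists j, P j.
Proof. exact: filter_ex. Qed.

(** A union of finitely many sets belongs to an ultrafilter only if one of
    them does. *)
Lemma ae_choose (X : choiceType) (D : {fset X}) (Q : X -> nat -> Prop) :
  (forall j, exists2 u, u \in D & Q u j) ->
  exists2 u, u \in D & V [set j | Q u j].
Proof.
move=> DQ; apply: contrapT => nV.
have : V [set j | forall u, u \in D -> ~ Q u j].
  apply: ae_all => u uD.
  have [VQ|//] := in_ultra_setVsetC [set j | Q u j] Vultra.
  by case: nV; exists u.
by move=> /ae_ex[j /= nQ]; have [u /nQ] := DQ j.
Qed.

Lemma ae_avoid F :
  V [set j | d j \notin F /\ forall x, x \in F -> ~ exch setT x (d j)].
Proof.
have [M MP] := sequence_avoids F dP; apply: Voo; exists M => // j /= Mj.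
split=> [|x xF]; last exact: MP.
by apply/negP => /(MP _ _ Mj); apply; exact: exch_refl.
Qed.

(** An iterated limit: for [V]-almost all [j1], then for [V]-almost all [j2],
    and so on up to [jr], the points [d j1], ..., [d jr] together with [F]
    form a set isomorphic to [A]. *)
Fixpoint limit_type (r : nat) F A : Prop :=
  if r is r'.+1 then V [set j | limit_type r' (d j |` F)%fset A]
  else fiso F A.

Lemma limit_type_fiso r F A B :
  limit_type r F A -> fiso A B -> limit_type r F B.
Proof.
move=> + AB; elim: r F => [|r IH] F /=; first by move=> /fiso_trans; apply.
by apply: filterS => j; exact: IH.
Qed.

Lemma limit_type_uniq r F A B :
  limit_type r F A -> limit_type r F B -> fiso A B.
Proof.
elim: r F => [|r IH] F /=; first by move=> /fiso_sym; exact: fiso_trans.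
by move=> FA FB; have /ae_ex[j [/IH jA /jA]] := ae_and FA FB.
Qed.

(** Up to isomorphism there are finitely many structures on [#|F| + r] points,
    so the ultrafilter selects one of them. *)
Lemma limit_type_exists r F : exists A, limit_type r F A.
Proof.
have [Z ZP] := oligomorphic_fset Roligo (#|` F| + r).
suff : exists2 A, A \in fpowerset Z & limit_type r F A by move=> [A _]; exists A.
move En : (#|` F| + r)%N ZP => n ZP.
have {En} : (#|` F| + r <= n)%N by rewrite En.
elim: r F => [|r IH] F Fr /=.
  have [|g [giso gZ]] := ZP F; first by rewrite addn0 in Fr.
  by exists (g @` F)%fset; [rewrite fpowersetE | exact: fiso_iso_img].
apply: (ae_choose (Q := fun A j => limit_type r (d j |` F)%fset A)) => j.
apply: IH; rewrite cardfsU1; apply: leq_trans Fr.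
by case: (_ \notin _) => /=; lia.
Qed.

(** Almost every [d j] realizes the limit for all [A] simultaneously, because
    the limit is determined by a single [A]. *)
Lemma limit_type_ae r F :
  V [set j | forall A, limit_type r (d j |` F)%fset A <-> limit_type r.+1 F A].
Proof.
have [A0 FA0] := limit_type_exists r.+1 F.
apply: filterS (FA0) => j jA0 A; split=> jA.
  by apply: limit_type_fiso FA0 _; exact: limit_type_uniq jA0 jA.
by apply: limit_type_fiso jA0 _; exact: limit_type_uniq FA0 jA.
Qed.

(** Adjoining generic points does not separate exchangeable points. *)
Lemma limit_type_exch r F A c c' : exch setT c c' ->
  c \notin F -> c' \notin F ->
  limit_type r (c |` F)%fset A -> limit_type r (c' |` F)%fset A.
Proof.
move=> cc'; elim: r F => [|r IH] F cF c'F /=.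
  by apply: fiso_trans; apply/fiso_sym/cc'.
move=> VA; have := ae_and VA (ae_avoid [fset c; c']%fset).
apply: filterS => j /= [+ [+ _]]; rewrite !inE negb_or => + /andP[jc jc'].
by rewrite !(fsetUCA [fset d j]%fset); apply: IH;
  rewrite !inE negb_or eq_sym ?jc ?jc'.
Qed.

(** The first point [d j] is chosen so that it realizes the limits over all
    subsets of [F0], and the other points generically over [d j |` F0]. So
    every subset of [Y] has a type over [F0] that depends only on its size. *)
Lemma generic_fset k F0 : exists Y : {fset R},
  [/\ #|` Y| = k, forall y, y \in Y -> y \notin F0 &
    forall F Y' A, (F `<=` F0)%fset -> (Y' `<=` Y)%fset ->
      fiso (Y' `|` F)%fset A <-> limit_type #|` Y'| F A].
Proof.
elim: k F0 => [|k IH] F0.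
  exists fset0; split; [exact: cardfs0|by move=> y; rewrite inE|].
  by move=> F Y' A _; rewrite fsubset0 => /eqP ->; rewrite cardfs0 fset0U.
have : V [set j | forall u : {fset R} * nat,
    u \in (fpowerset F0 `*` [fset r in iota 0 k.+1])%fset ->
    forall A, limit_type u.2 (d j |` u.1)%fset A <-> limit_type u.2.+1 u.1 A].
  by apply: ae_all => -[F r] _; exact: limit_type_ae.
move=> /ae_and /(_ (ae_avoid F0)) /ae_ex[j [/= jP [jF0 _]]].
have [Y [Yk YF0 YP]] := IH (d j |` F0)%fset.
have jY : d j \notin Y.
  by apply/negP => /YF0; rewrite fset1U1.
exists (d j |` Y)%fset; split.
- by rewrite cardfsU1 jY Yk.
- move=> y; rewrite in_fset1U => /orP[/eqP ->//|/YF0].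
  by rewrite in_fset1U negb_or => /andP[].
- move=> F Y' A FF0 Y'Y.
  have [jY'|jY'] := boolP (d j \in Y'); last first.
    apply: YP; first exact: fsubset_trans FF0 (fsubsetU1 _ _).
    apply/fsubsetP => y yY'; have := fsubsetP Y'Y y yY'.
    by rewrite in_fset1U => /orP[/eqP yj|//]; move: jY'; rewrite -yj yY'.
  pose Y1 := (Y' `\ d j)%fset.
  have Y1Y : (Y1 `<=` Y)%fset.
    apply/fsubsetP => y; rewrite in_fsetD1 => /andP[yj /(fsubsetP Y'Y)].
    by rewrite in_fset1U (negbTE yj).
  have Y1k : (#|` Y1| <= k)%N by rewrite -Yk fsubset_leq_card.
  rewrite (cardfsD1 (d j) Y') jY' -/Y1 add1n.
  apply: iff_trans (jP (F, #|` Y1|) _ A); last first.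
    rewrite in_fsetM; apply/andP; split; first by rewrite fpowersetE.
    have kY : #|` Y1| \in iota 0 k.+1 by rewrite mem_iota.
    by rewrite in_fset; exact: kY.
  apply: iff_trans (YP _ Y1 A _ Y1Y); last exact: fsetUS.
  by rewrite -{1}(fsetD1K jY') -/Y1 fsetUCA fsetUA.
Qed.

Definition absorbing (c : R) : Prop :=
  forall F, c \notin F -> V [set j | fiso (d j |` F)%fset (c |` F)%fset].

(** The delicate case is that of a set [F] containing [c]: there [c] is traded
    for [c'] next to [d j], then [d j] for [c]. *)
Lemma absorbing_exch c c' : exch setT c c' -> absorbing c -> absorbing c'.
Proof.
move=> cc' cabs F c'F; have [cF|cF] := boolP (c \in F); last first.
  by apply: filterS (cabs F cF) => j /= /fiso_trans; apply; exact: cc'.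
have cc : c != c' by apply: contraNneq c'F => <-.
pose G := (F `\ c)%fset.
have cG : c \notin (c' |` G)%fset by rewrite !inE negb_or cc eqxx.
have := ae_and (cabs _ cG) (ae_avoid [fset c; c']%fset).
apply: filterS => j /= [jc [+ _]]; rewrite !inE negb_or => /andP[dc dc'].
rewrite -(fsetD1K cF) -/G fsetUCA [(c' |` _)%fset]fsetUCA.
apply: fiso_trans jc; rewrite [(d j |` (c' |` _))%fset]fsetUCA.
apply: cc' => //; rewrite !inE ?eqxx ?negb_or ?negb_and.
  by rewrite eq_sym dc.
by rewrite eq_sym dc' /= (negbTE c'F) orbT.
Qed.

(** A lost point is replaced by some [d j] in another class, whatever the size
    of [H]; so the set [S] of points of the class that are kept is arbitrary.
    *)
Lemma absorbing_replaceable c (S : set R) n : absorbing c ->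
  replaceable (~` exch_class setT c `|` S) n.
Proof.
move=> cabs H z /not_orP[/contrapT [_ cz] _] zH _.
have zabs := absorbing_exch cz cabs.
have : V [set j | forall G, G \in fpowerset H ->
    fiso (d j |` G)%fset (z |` G)%fset].
  apply: ae_all => G; rewrite fpowersetE => /fsubsetP GH; apply: zabs.
  by apply: contra zH; exact: GH.
move=> /ae_and /(_ (ae_avoid (z |` H)%fset)) /ae_ex[j [/= jP [jH jn]]].
exists (d j); split.
- left=> -[_ cj]; apply: (jn z); first exact: fset1U1.
  by apply: exch_trans cj => //; exact: exch_sym.
- by apply: contra jH; exact: fset1Ur.
- by move=> G GH; apply/fiso_sym/jP; rewrite fpowersetE.
Qed.

End LimitTypes.

(** * Infinitely many siblings *)

(** The bound [M] separates such siblings for different [k]; see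
    [infinite_sib_unbounded]. *)
Definition sibling_with_class (I : Type) (ar : I -> nat) (R S : structure ar)
    (k : nat) : Prop :=
  [/\ sibling R S, exists2 n, (k <= n)%N & has_class_card S n &
    exists M, forall n, has_class_card S n -> (n <= M)%N].

Section Infinite.
Variables (I : Type) (ar : I -> nat) (R : structure ar).
Hypotheses (Rcount : countable [set: R]) (Roligo : oligomorphic (Aut R)).
Variables (d : nat -> R) (V : set_system nat).
Hypotheses (dP : forall i j, i <> j -> ~ exch setT (d i) (d j))
  (Vultra : UltraFilter V) (Voo : eventually `<=` V).
Implicit Types (F G H A B : {fset R}).

(** By compactness. The class of [c] is not invariant under automorphisms, so
    the conditions speak of a conjugate of [c], found together with the map.
    *)
Lemma emb_off_absorbing c : absorbing d V c ->
  exists phi : R -> R, emb_on setT phi /\ forall r, ~ exch_class setT c (phi r).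
Proof.
move=> cabs; have [code injcode] := countable_sum_code Rcount unit.
pose P (K : {fset (R + unit)%type}) (x : (R + unit)%type -> R) :=
  [/\ inr tt \in K -> exists g : R -> R, is_iso g /\ g c = x (inr tt),
      emb_on [set r | inl r \in K] (x \o inl) &
      forall r, inl r \in K -> inr tt \in K ->
        ~ exch setT (x (inr tt)) (x (inl r))].
have [| | | |x xP] := compactness Roligo (P := P) injcode.
- move=> K x y xy [xc xe xr]; split.
  + by move=> cK; rewrite -xy//; exact: xc.
  + by apply: emb_on_eq xe => r /= rK; exact: xy.
  + by move=> r rK cK; rewrite -!xy//; exact: xr.
- move=> K x g giso [xc xe xr]; split.
  + move=> /xc[h [hiso hc]]; exists (g \o h); split; last by rewrite /= hc.
    exact: is_iso_comp.
  + exact: (emb_on_comp (B := setT)) xe (is_iso_emb giso).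
  + by move=> r rK cK /(exch_aut _ _ giso); exact: xr.
- move=> K K' x /fsubsetP KK' [xc xe xr]; split.
  + by move=> /KK'; exact: xc.
  + by apply: emb_on_sub xe => r /= /KK'.
  + by move=> r /KK' rK /KK'; exact: xr.
- move=> K.
  have [F FP] := fset_inl K.
  have rep := absorbing_replaceable (S := set0) (n := #|` F|) dP Vultra Voo cabs.
  have [||F' [F'A _ F'P]] := replaceable_move (W := fset0) (F := F) rep.
  + by move=> u; rewrite inE.
  + by rewrite fset0U.
  have := F'P _ (fsubset_refl _); rewrite !fset0U => /isomorphic_emb[f [ef fF]].
  exists (fun u => match u with inl r => f r | inr _ => c end); split.
  + by move=> _; exists id; split=> //; exact: is_iso_id.
  + by apply: emb_on_sub ef => r /= /FP.
  + move=> r /FP rF _ cfr; have : [set` F'] (f r) by rewrite -fF; exists r.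
    by move=> /F'A [[]|//]; split.
have [/(_ (fset11 _))[g [giso gc]] _ _] := xP [fset inr tt]%fset.
have [h [hiso gh hg]] := is_iso_inv giso.
exists (h \o (x \o inl)); split.
  apply: (emb_on_comp (B := setT)) (is_iso_emb hiso) => //.
  apply: emb_of_finite => F; exists (x \o inl); split=> //.
  have [_ xe _] := xP (inl @` F)%fset; apply: emb_on_sub xe => r /= rF.
  exact: in_imfset.
move=> r [_] /(exch_aut _ _ giso); rewrite /= hg gc.
by have [_ _] := xP [fset inl r; inr tt]%fset; apply; rewrite !inE eqxx ?orbT.
Qed.

Lemma shrunk_absorbing_sibling c k : (0 < k)%N ->
  absorbing d V c -> infinite_set (exch_class setT c) ->
  exists S, sibling_with_class R S k.
Proof.
move=> k0 cabs cinf.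
have [phi [ephi phic]] := emb_off_absorbing cabs.
have [N NP] := witness_bound_exists Roligo.
have [m mP] := finite_class_bounded Roligo.
have [B [BC Bk]] := infinite_set_fset_eq k cinf.
pose A := ~` exch_class setT c `|` [set` B].
have rep : replaceable A N.+1 := absorbing_replaceable dP Vultra Voo cabs.
have classE x := class_replaceable x NP rep.
have small x : exch_class setT c x -> exch_class A x = [set` B].
  move=> [_ cx]; rewrite classE; apply/seteqP; split=> y.
    by move=> [[nc|//] [_ xy]]; case: nc; split=> //; exact: exch_trans xy.
  move=> /= yB; split; first by right.
  split=> //; apply: (@exch_trans _ _ _ _ _ c) => //; first exact: exch_sym.
  exact: (BC y yB).2.
exists (restriction A); split.
- by apply: (sibling_restriction ephi) => r; left; exact: phic.
- have [x xB] : exists x, x \in B by apply/fset0Pn; rewrite -cardfs_gt0 Bk.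
  exists k => //; apply/has_class_card_restriction; exists x; first by right.
  by rewrite small; [apply/card_eq_fsetP | exact: BC].
- exists (maxn k m) => n /has_class_card_restriction[x Ax xn].
  have [cx|ncx] := pselect (exch_class setT c x).
    have : [set` B] #= `I_n by rewrite -(small x).
    by move=> /card_eq_fsetP <-; rewrite Bk leq_max leqnn.
  rewrite leq_max (mP x n) ?orbT// -(_ : exch_class A x = exch_class setT x)//.
  rewrite classE; apply/setIidPr => y [_ xy]; left=> -[_ cy].
  by apply: ncx; split=> //; apply: exch_trans cy _ => //; exact: exch_sym.
Qed.

(** By compactness. The values of [limit_type] refer to [F] in [R] and not to
    its image under [phi], so the conditions are invariant under
    automorphisms. *)
Lemma generic_extension k : exists (phi : R -> R) (y : 'I_k -> R),
  [/\ emb_on setT phi, injective y, forall r i, phi r <> y i &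
    forall F (J : {fset 'I_k}) A,
      fiso (y @` J `|` phi @` F)%fset A <-> limit_type d V #|` J| F A].
Proof.
have [c injc] := countable_sum_code Rcount 'I_k.
pose P (K : {fset (R + 'I_k)%type}) (x : (R + 'I_k)%type -> R) :=
  (exists g : R -> R, is_iso g /\ forall r, inl r \in K -> g r = x (inl r)) /\
  ((forall i, inr i \in K) ->
    [/\ injective (x \o inr),
      forall r i, inl r \in K -> x (inl r) <> x (inr i) &
      forall F, (forall r, r \in F -> inl r \in K) ->
      forall (J : {fset 'I_k}) A,
        fiso ((x \o inr) @` J `|` (x \o inl) @` F)%fset A <->
        limit_type d V #|` J| F A]).
have [| | | |x xP] := compactness Roligo (P := P) injc.
- move=> K x y xy [[g [giso gx]] xg]; split.
    by exists g; split=> // r rK; rewrite gx// xy.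
  move=> kK; have [xinj xN xF] := xg kK.
  have xyr i : x (inr i) = y (inr i) by apply: xy; exact: kK.
  split.
  + by move=> i j /= ij; apply: xinj; rewrite /= !xyr.
  + by move=> r i rK; rewrite -xy// -xyr; exact: xN.
  + move=> F FK J A; rewrite -xF//.
    have -> : ((x \o inr) @` J = (y \o inr) @` J)%fset.
      by apply: eq_in_imfset => i _ /=.
    have -> // : ((x \o inl) @` F = (y \o inl) @` F)%fset.
    by apply: eq_in_imfset => r rF /=; apply: xy; exact: FK.
- move=> K x h hiso [[g [giso gx]] xg]; split.
    exists (h \o g); split; first exact: is_iso_comp.
    by move=> r rK /=; rewrite gx.
  have injh : injective h by exact: bij_inj hiso.1.
  move=> /xg[xinj xN xF]; split.
  + by move=> i j /= /injh /xinj.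
  + by move=> r i rK /= /injh; exact: xN.
  + move=> F FK J A; rewrite -xF//.
    rewrite (_ : (_ `|` _) =
        h @` ((x \o inr) @` J `|` (x \o inl) @` F))%fset.
      split; first by apply: fiso_trans; exact: fiso_iso_img.
      by apply: fiso_trans; apply/fiso_sym; exact: fiso_iso_img.
    by rewrite imfsetU -!imfset_comp.
- move=> K K' x /fsubsetP KK' [[g [giso gx]] xg]; split.
    by exists g; split=> // r /KK'; exact: gx.
  move=> kK; have [|xinj xN xF] := xg; first by move=> i; exact: KK'.
  split=> //; first by move=> r i /KK'; exact: xN.
  by move=> F FK; apply: xF => r /FK /KK'.
- move=> K.
  have [F0 FP] := fset_inl K.
  have [Y [Yk YF0 YP]] := generic_fset Roligo dP Vultra Voo k F0.
  pose y (i : 'I_k) : R := nth (d 0) (enum_fset Y) i.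
  have yY i : y i \in Y by apply: mem_nth; rewrite Yk.
  have injy : injective y.
    by move=> i j /eqP; rewrite nth_uniq ?Yk ?fset_uniq// => /eqP /val_inj.
  exists (fun u => match u with inl r => r | inr i => y i end); split.
    by exists id; split=> //; exact: is_iso_id.
  move=> _; split=> //.
  + by move=> r i /FP rF /= ri; have := YF0 _ (yY i); rewrite -ri rF.
  + move=> F FK J A; rewrite (_ : ((_ \o inl) @` F)%fset = F); last first.
      by rewrite -[RHS]imfset_id; apply: eq_in_imfset.
    rewrite YP; first by rewrite card_imfset.
      by apply/fsubsetP => r /FK /FP.
    by apply/fsubsetP => _ /imfsetP[/= i _ ->].
have [_ [|xinj _ _]] := xP (inr @` [fset i | i in 'I_k])%fset.
  by move=> i; apply: in_imfset; rewrite inE.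
have full (F : {fset R}) : exists K : {fset (R + 'I_k)%type},
    (forall i, inr i \in K) /\ forall r, r \in F -> inl r \in K.
  exists (inr @` [fset i | i in 'I_k] `|` inl @` F)%fset.
  split=> [i|r rF]; rewrite in_fsetU; apply/orP; [left|right].
    by apply: in_imfset; rewrite inE.
  exact: in_imfset.
exists (x \o inl), (x \o inr); split=> //.
- apply: emb_of_finite => F; have [K [_ FK]] := full F.
  have [[g [giso gx]] _] := xP K; exists g; split.
    by apply: emb_on_sub (is_iso_emb giso).
  by move=> r /FK; exact: gx.
- move=> r i; have [K [kK FK]] := full [fset r]%fset.
  by have [_ /(_ kK)[_ + _]] := xP K; apply; apply: FK; rewrite inE.
- move=> F; have [K [kK FK]] := full F.
  by have [_ /(_ kK)[_ _ +]] := xP K; apply; exact: FK.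
Qed.

(** The domain is the image of [phi] with the generic points [y i]. Two
    classes of [R] are neither merged nor split, and a class that the points
    [y i] join is absorbing; so the classes are those of [R], except that the
    [k] points form one on their own or enlarge a finite one. *)
Lemma inflated_sibling k : (0 < k)%N ->
  (forall c, absorbing d V c -> finite_set (exch_class setT c)) ->
  exists S, sibling_with_class R S k.
Proof.
move=> k0 absfin; have [phi [y [ephi injy phiy extP]]] := generic_extension k.
have [m mP] := finite_class_bounded Roligo.
have injphi : injective phi by move=> u v; exact: ephi.1.
pose A := range phi `|` range y.
have Aphi r : A (phi r) by left; exists r.
have Ay i : A (y i) by right; exists i.
have split_fset F : [set` F] `<=` A ->
    exists (J : {fset 'I_k}) (G : {fset R}), F = (y @` J `|` phi @` G)%fset.
  elim/fset1U_rect: F => [_|u F _ IH uF].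
    by exists fset0, fset0; rewrite !imfset0 fset0U.
  have [|J [G ->]] := IH.
    by move=> z zF; apply: uF; rewrite /= in_fset1U; apply/orP; right.
  have [|[r _ <-]|[i _ <-]] := uF u; first by rewrite /= fset1U1.
    by exists J, (r |` G)%fset; rewrite imfsetU1 fsetUCA.
  by exists (i |` J)%fset, G; rewrite imfsetU1 fsetUA.
have memy (J : {fset 'I_k}) G i : (y i \in y @` J `|` phi @` G)%fset = (i \in J).
  rewrite in_fsetU mem_imfset//=; case: (i \in J) => //=.
  by apply/imfsetP => -[/= r _ /esym /phiy].
have memphi (J : {fset 'I_k}) G r :
    (phi r \in y @` J `|` phi @` G)%fset = (r \in G).
  rewrite in_fsetU orbC mem_imfset//=; case: (r \in G) => //=.
  by apply/imfsetP => -[/= i _ /phiy].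
have yJ i (J : {fset 'I_k}) G :
    (y i |` (y @` J `|` phi @` G) = y @` (i |` J) `|` phi @` G)%fset.
  by rewrite imfsetU1 fsetUA.
have phiG r (J : {fset 'I_k}) G :
    (phi r |` (y @` J `|` phi @` G) = y @` J `|` phi @` (r |` G))%fset.
  by rewrite imfsetU1 fsetUCA.
have exch_y i j : exch A (y i) (y j).
  move=> F /split_fset[J [G ->]]; rewrite !memy !yJ => iJ jJ.
  apply/extP; rewrite cardfsU1 iJ.
  have/extP := fiso_refl (y @` (j |` J) `|` phi @` G)%fset.
  by rewrite cardfsU1 jJ.
have exch_phi c c' : exch setT c c' -> exch A (phi c) (phi c').
  move=> cc' F /split_fset[J [G ->]]; rewrite !memphi !phiG => cG c'G.
  apply/extP; apply: (limit_type_exch dP Vultra Voo (exch_sym cc')) => //.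
  by apply/extP; exact: fiso_refl.
have exch_phiV c c' : exch A (phi c) (phi c') -> exch setT c c'.
  move=> cc'; apply/(exch_emb _ _ ephi); apply: exch_sub cc' => u [r _ <-].
  exact: Aphi.
(* A generic point exchangeable with [phi c] has over the image of [F] the
   type of [phi c], and over [F] it has the limit type. *)
have exch_abs c i : exch A (phi c) (y i) -> absorbing d V c.
  move=> ci F cF; have /= := ci (phi @` F)%fset.
  have mphi : (phi c \in phi @` F)%fset = (c \in F) by exact: mem_imfset.
  rewrite mphi => /(_ _ cF) ciF.
  have : fiso (y @` [fset i] `|` phi @` F)%fset (c |` F)%fset.
    rewrite imfset_fset1; apply: (@fiso_trans _ _ _ _ _ (phi c |` phi @` F)%fset).
      apply/fiso_sym/ciF; first by move=> _ /imfsetP[/= r _ ->].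
      by apply/imfsetP => -[/= r _ /esym /phiy].
    by rewrite -imfsetU1; apply/fiso_sym/fiso_emb_img.
  by move=> /extP; rewrite cardfs1.
have trace z : A z -> exists C : set R, [/\
    exch_class A z `<=` range y `|` phi @` C,
    phi @` C `<=` exch_class A z &
    C = set0 \/ exists2 c, exch A (phi c) z & C = exch_class setT c].
  move=> Az; have [[c cz]|nc] := pselect (exists c, exch A (phi c) z).
    exists (exch_class setT c); split; last by right; exists c.
      move=> _ [[[r _ <-]|[i _ <-]] zr]; last by left; exists i.
      right; exists r => //; split=> //; apply: exch_phiV.
      exact: exch_trans cz zr.
    move=> _ [r [_ cr] <-]; split=> //.
    apply: (@exch_trans _ _ _ _ _ (phi c)) => //; first exact: exch_sym.
    exact: exch_phi.
  exists set0; split; [|by move=> _ [r []]|by left].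
  move=> _ [[[r _ <-]|[i _ <-]] zr]; last by left; exists i.
  by case: nc; exists r; exact: exch_sym.
have cardI : #|` [fset i | i in 'I_k]%fset| = k.
  by rewrite card_imfset//= size_enum_ord.
have finy : finite_set (range y).
  by apply: finite_image; exact: finite_finset.
exists (restriction A); split.
- exact: (sibling_restriction ephi).
- pose i0 : 'I_k := Ordinal k0.
  have [C [yC _ CE]] := trace (y i0) (Ay i0).
  have finC : finite_set C.
    case: CE => [->|[c /exch_abs/absfin cfin ->//]]; exact: finite_set0.
  have fin : finite_set (exch_class A (y i0)).
    apply: sub_finite_set yC _; rewrite finite_setU; split=> //.
    exact: finite_image.
  have /finite_setP[n yn] := fin; exists n; last first.
    by apply/has_class_card_restriction; exists (y i0).
  have ysub :
      (y @` [fset i | i in 'I_k] `<=` fset_set (exch_class A (y i0)))%fset.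
    apply/fsubsetP => _ /imfsetP[/= i _ ->]; rewrite in_fset_set//.
    by apply/mem_set; split=> //; exact: exch_y.
  rewrite -(card_fset_set yn) (leq_trans _ (fsubset_leq_card ysub))//.
  by rewrite -[leqLHS]cardI [leqRHS]card_imfset.
- exists (k + m)%N => n /has_class_card_restriction[z Az zn].
  have [C [zC Cz CE]] := trace z Az.
  have finz : finite_set (exch_class A z) by apply/finite_setP; exists n.
  have finC : finite_set C.
    rewrite -(eq_finite_set (inj_card_eq (f := phi) _)).
      exact: sub_finite_set Cz finz.
    by move=> u v _ _; exact: injphi.
  have Cm : (#|` fset_set C| <= m)%N.
    case: CE => [->|[c _ Cc]]; first by rewrite fset_set0 cardfs0.
    have /finite_setP[l Cl] := finC.
    by rewrite (card_fset_set Cl); apply: (mP c); rewrite -Cc.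
  rewrite -(card_fset_set zn).
  pose Y := (y @` [fset i | i in 'I_k] `|` phi @` fset_set C)%fset.
  have zY : (fset_set (exch_class A z) `<=` Y)%fset.
    apply/fsubsetP => u; rewrite in_fset_set// => /set_mem /zC.
    move=> [[i _ <-]|[r Cr <-]]; rewrite in_fsetU; apply/orP; [left|right].
      by apply: in_imfset; rewrite inE.
    by apply: in_imfset; rewrite in_fset_set//; exact: mem_set.
  apply: leq_trans (fsubset_leq_card zY) _; rewrite cardfsU.
  apply: leq_trans (leq_subr _ _) _; apply: leq_add.
    by rewrite -[leqRHS]cardI card_imfset.
  by rewrite card_imfset.
Qed.

(** The siblings of finitely many isomorphism types would have a common bound
    on the sizes of their finite classes. *)
Lemma infinite_sib_unbounded :
  (forall k, (0 < k)%N -> exists S, sibling_with_class R S k) ->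
  infinite_set (sib R).
Proof.
move=> Sex fin.
have [S SP] := choice (fun k => Sex k.+1 (ltn0Sn k)).
have SM k : exists M, forall n, has_class_card (S k) n -> (n <= M)%N.
  by have [] := SP k.
have [M MP] := choice SM.
have [|D [finD _ DP]] := @finite_image_reps _ _ (fun k => iso_class (S k)) setT.
  apply: sub_finite_set fin => _ [k _ <-]; exists (S k) => //.
  by have [] := SP k.
pose b := \max_(k <- fset_set D) M k.
have [k Dk kb] := DP b Logic.I.
have [_ [n bn Sn] _] := SP b.
have := MP k n (has_class_card_iso (isomorphic_sym (iso_class_inj kb)) Sn).
have kb' : (M k <= b)%N.
  apply: (@leq_bigmax_seq _ (enum_fset _) xpredT M k) => //.
  by rewrite in_fset_set//; exact: mem_set.
by move=> nM; have := leq_trans nM kb'; rewrite leqNgt bn.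
Qed.

Lemma infinite_sib : infinite_set (sib R).
Proof.
apply: infinite_sib_unbounded => k k0.
have [[c [cabs cinf]]|nc] :=
    pselect (exists c, absorbing d V c /\ infinite_set (exch_class setT c)).
  exact: shrunk_absorbing_sibling cabs cinf.
apply: inflated_sibling => // c cabs; apply: contrapT => cinf.
by apply: nc; exists c.
Qed.

End Infinite.

Theorem theorem6p1 (I : Type) (ar : I -> nat) (R : structure ar)
  (Rcount : countable [set: R])
  (Rprehom : prehomogeneous R)
  (Roligo : oligomorphic (Aut R)) :
  (infinite_set [set C : set R | monomorphic_component C] ->
     infinite_set (sib R))
  /\
  (infinite_set [set C : set R | monomorphic_component C /\ infinite_set C] ->
     sib R #= [set: set nat]).
Proof.
split=> Cinf; last first.
  have [d [dinf dP]] := components_sequence Cinf.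
  exact: sib_continuum dinf dP.
have [|d [_ dP]] := @components_sequence I ar R (fun _ => True).
  by apply: sub_infinite_set Cinf => C.
have [V [Vultra Voo]] := ultraFilterLemma eventually_filter.
exact: infinite_sib dP Vultra Voo.
Qed.
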